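(* Let $A,B\in\mathbb{R}^{N\times N}$, $\tau\ge0$, $\Delta t>0$, $\epsilon>0$. Set $D=\tau B-A$ and $I=\{i\in\{1,\dots,N\}:D_{ii}<0\}$. Assume that: (i) $Id+sB$ is an $M$-matrix for every $s>0$; (ii) $D_{ij}\ge0$ for all $i\ne j$, and $0<\Delta t<\frac{1}{\max_{i\in I}|D_{ii}|}$; (iii) $\mathrm{Ker}(A)=\mathrm{Ker}(B)=\mathrm{span}\{{\bf 1}\}$, where ${\bf 1}=(1,\dots,1)^T\in\mathbb{R}^N$; (iv) $|u^{(0)}_i|\le1$ for $i=1,\dots,N$. Then the sequence $(u^{(k)})_{k\ge0}$ defined by $$\frac{u^{*}-u^{(k)}}{\Delta t}+\tau B(u^*-u^{(k)})=-Au^{(k)},\qquad u^{(k+1)}=\frac{u^*}{\sqrt{e^{-2\Delta t/\epsilon^2}+(u^* )^2\left(1-e^{-2\Delta t/\epsilon^2}\right)}}$$ satisfies $|u^{(k)}_i|\le1$ for $i=1,\dots,N$ and all $k\ge0$.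
   Context: The formula for $u^{(k+1)}$ is understood componentwise. An $M$-matrix is a nonsingular matrix with nonpositive off-diagonal entries whose inverse has nonnegative entries. If $I$ is empty, the upper bound on $\Delta t$ imposes no restriction. *)

(* Defs.v *)
From HB Require Import structures.
From mathcomp Require Import all_boot all_order all_algebra.
From mathcomp Require Import reals sequences exp.
Set Implicit Arguments.
Unset Strict Implicit.
Unset Printing Implicit Defensive.
Import Order.TTheory GRing.Theory Num.Theory.
Local Open Scope ring_scope.

Definition is_M_matrix (R : realType) (N : nat) (M : 'M[R]_N) : Prop :=
  [/\ M \in unitmx,
      forall i j : 'I_N, i != j -> M i j <= 0
    & forall i j : 'I_N, 0 <= invmx M i j].

(* The kernel for the action on column vectors; kermx is the kernel for the
   action on row vectors. *)
Definition Ker (R : realType) (N : nat) (A : 'M[R]_N) : {vspace 'cV[R]_N} :=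
  lker (linfun (mulmx A)).

Definition ones (R : realType) (N : nat) : 'cV[R]_N := const_mx 1.

Definition linear_step (R : realType) (N : nat) (A B : 'M[R]_N) (tau dt : R)
    (u ustar : 'cV[R]_N) : Prop :=
  dt^-1 *: (ustar - u) + tau *: (B *m (ustar - u)) = - (A *m u).

Definition nonlinear_step (R : realType) (N : nat) (dt eps : R)
    (ustar : 'cV[R]_N) : 'cV[R]_N :=
  let E := expR (- (2 * dt / eps ^+ 2)) in
  \col_i (ustar i ord0 / Num.sqrt (E + ustar i ord0 ^+ 2 * (1 - E))).

Definition is_scheme (R : realType) (N : nat) (A B : 'M[R]_N)
    (tau dt eps : R) (u : nat -> 'cV[R]_N) : Prop :=
  forall k : nat, exists ustar : 'cV[R]_N,
    linear_step A B tau dt (u k) ustar /\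
    u k.+1 = nonlinear_step dt eps ustar.

Lemma mem_Ker (R : realType) (N : nat) (A : 'M[R]_N) (v : 'cV[R]_N) :
  (v \in Ker A) = (A *m v == 0).
Proof. by rewrite memv_ker lfunE. Qed.

(* The intermediate state exists and is unique, so that the scheme does define
   a sequence. *)
Lemma linear_step_wd (R : realType) (N : nat) (A B : 'M[R]_N) (tau dt : R)
    (u : 'cV[R]_N) :
  0 <= tau -> 0 < dt ->
  (forall s : R, 0 < s -> is_M_matrix (1%:M + s *: B)) ->
  exists! ustar : 'cV[R]_N, linear_step A B tau dt u ustar.
Proof.
move=> tau0 dt0 HB.
set M := 1%:M + (dt * tau) *: B.
have Mu : M \in unitmx.
  move: tau0; rewrite le_eqVlt => /orP[/eqP tau0|tau0].
    by rewrite /M -tau0 mulr0 scale0r addr0 unitmx1.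
  by have [] := HB _ (mulr_gt0 dt0 tau0).
have dtn : dt != 0 by rewrite gt_eqF.
have E v : linear_step A B tau dt u v <-> M *m (v - u) = - (dt *: (A *m u)).
  rewrite /linear_step /M mulmxDl mul1mx -scalemxAl -scalerA -scalerN.
  split=> [<-|H]; first by rewrite scalerDr (scalerA dt dt^-1) mulfV // scale1r.
  by apply: (scalerI dtn); rewrite -H scalerDr (scalerA dt dt^-1) mulfV // scale1r.
exists (u - invmx M *m (dt *: (A *m u))); split.
  by apply/E; rewrite addrAC subrr add0r mulmxN mulKVmx.
move=> v /E H; rewrite -[RHS](subrK u) -(mulKmx Mu (v - u)) H mulmxN.
by rewrite addrC.
Qed.

(* Main.v *)
Require Import Defs.
From mathcomp Require Import all_boot all_order all_algebra.
From mathcomp Require Import reals sequences exp.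
Import Order.TTheory GRing.Theory Num.Theory.
Local Open Scope ring_scope.

(** With [D = tau *: B - A] the linear step reads
    [(1 + dt tau B) ustar = (1 + dt D) u].  Both matrices fix the constant
    vector [ones], because [A] and [B] annihilate it.  The sign conditions on
    the off-diagonal part of [D], together with the bound on [dt] on its
    negative diagonal entries, make [1 + dt D] entrywise nonnegative; the
    M-matrix property makes the inverse of [1 + dt tau B] entrywise
    nonnegative.  So [ustar] is obtained from [u] by applying two
    row-stochastic matrices, each of which replaces the entries of a vector by
    convex combinations of them ([norm_stochastic_mul_le1]); hence the bound
    [1] passes from [u] to [ustar].

    The nonlinear step is the exact flow of the double-well equation, whose
    equilibria [-1] and [1] enclose an invariant interval.  Concretely, its
    denominator dominates [`|x|] as soon as [`|x| <= 1]
    ([norm_nonlinear_le1]). *)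

(** Each entry of [P *m v] is a convex combination of the entries of [v]. *)
Lemma norm_stochastic_mul_le1 {R : realType} {N : nat} (P : 'M[R]_N)
    (v : 'cV[R]_N) :
  (forall i j, 0 <= P i j) -> P *m ones R N = ones R N ->
  (forall i, `|v i ord0| <= 1) ->
  forall i, `|(P *m v) i ord0| <= 1.
Proof.
move=> P_ge0 P1 v_le1 i.
have <- : (P *m ones R N) i ord0 = 1 by rewrite P1 mxE.
rewrite !mxE; apply: le_trans (ler_norm_sum _ _ _) _.
apply: ler_sum => j _; rewrite normrM (ger0_norm (P_ge0 i j)).
by rewrite ler_wpM2l // mxE.
Qed.

Lemma invmx_mul_fixed {R : realType} {N : nat} (M : 'M[R]_N) (v : 'cV[R]_N) :
  M \in unitmx -> M *m v = v -> invmx M *m v = v.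
Proof. by move=> Mu Mv; rewrite -{1}Mv mulKmx. Qed.

(** The case [s = 0], outside the range of the M-matrix hypothesis, is that
    of the identity matrix. *)
Lemma implicit_mx_inverse_ge0 {R : realType} {N : nat} {B : 'M[R]_N} {s : R} :
  (forall r : R, 0 < r -> is_M_matrix (1%:M + r *: B)) -> 0 <= s ->
  (1%:M + s *: B) \in unitmx /\ forall i j, 0 <= invmx (1%:M + s *: B) i j.
Proof.
move=> HM; rewrite le_eqVlt => /orP[/eqP <-|/HM[] //].
rewrite scale0r addr0 unitmx1 invmx1; split=> // i j.
by rewrite mxE ler0n.
Qed.

Lemma linear_stepE {R : realType} {N : nat} {A B : 'M[R]_N} {tau dt : R}
    {u v : 'cV[R]_N} :
  dt != 0 -> linear_step A B tau dt u v ->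
  (1%:M + (dt * tau) *: B) *m v = (1%:M + dt *: (tau *: B - A)) *m u.
Proof.
move=> dt0 /(congr1 ( *:%R dt)).
rewrite scalerDr !scalerA mulfV // scale1r scalerN => H.
rewrite -[v](subrK u) mulmxDr.
rewrite (mulmxDl _ _ (v - u)) mul1mx -scalemxAl H.
rewrite !mulmxDl !mul1mx -!scalemxAl mulmxBl -scalemxAl scalerBr scalerA.
by rewrite addrC addrA.
Qed.

(** On the diagonal, [1 + dt * D i i] could only be negative where [D i i] is,
    and there [dt * `|D i i| < 1]. *)
Lemma explicit_mx_ge0 {R : realType} {N : nat} (D : 'M[R]_N) (dt : R)
    (I := [set i : 'I_N | D i i < 0]) :
  0 < dt -> (forall i j, i != j -> 0 <= D i j) ->
  (I != set0 -> dt < 1 / \big[Num.max/0]_(i in I) `|D i i|) ->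
  forall i j, 0 <= (1%:M + dt *: D) i j.
Proof.
move=> dt0 HD Hdt i j; rewrite !mxE.
case: (eqVneq i j) => [<-|ij]; last by rewrite add0r mulr_ge0 ?HD // ltW.
have [Dii|Dii] := leP 0 (D i i); first by rewrite addr_ge0 ?mulr_ge0 // ltW.
have iI : i \in I by rewrite inE.
have /Hdt : I != set0 by apply/set0Pn; exists i.
set m := \big[_/_]_(_ in _) _ => dt_lt.
have Dm : `|D i i| <= m by apply: le_bigmax_cond.
have m0 : 0 < m by apply: lt_le_trans Dm; rewrite normr_gt0 lt_eqF.
rewrite ltr_pdivlMr // in dt_lt.
rewrite -[D i i]opprK mulrN subr_ge0 -(ltr0_norm Dii).
by apply: le_trans (ltW dt_lt); rewrite ler_wpM2l // ltW.
Qed.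

(** The radicand is [x ^+ 2 + E * (1 - x ^+ 2)], which is at least [x ^+ 2]
    on the interval between the two equilibria. *)
Lemma norm_nonlinear_le1 {R : realType} (E x : R) :
  0 < E -> `|x| <= 1 ->
  `|x / Num.sqrt (E + x ^+ 2 * (1 - E))| <= 1.
Proof.
move=> E0 x1.
have x2 : x ^+ 2 <= 1 by rewrite -real_normK ?num_real // expr_le1.
have le_rad : x ^+ 2 <= E + x ^+ 2 * (1 - E).
  rewrite mulrBr mulr1 addrCA lerDl subr_ge0.
  by rewrite ler_piMl // ltW.
rewrite normrM normfV (ger0_norm (sqrtr_ge0 _)).
(* If the denominator vanishes, so does the quotient, as [0^-1 = 0]. *)
have [->|s0] := eqVneq (Num.sqrt (E + x ^+ 2 * (1 - E))) 0.
  by rewrite invr0 mulr0 ler01.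
rewrite ler_pdivrMr ?lt_def ?s0 ?sqrtr_ge0 // mul1r -sqrtr_sqr.
exact: ler_wsqrtr.
Qed.

Theorem theorem3p6 (R : realType) (N : nat) (A B : 'M[R]_N)
    (tau dt eps : R) (u : nat -> 'cV[R]_N)
    (D := tau *: B - A) (I := [set i : 'I_N | D i i < 0])
    (tau_ge0 : 0 <= tau) (dt_gt0 : 0 < dt) (eps_gt0 : 0 < eps)
    (HM : forall s : R, 0 < s -> is_M_matrix (1%:M + s *: B))
    (HD : forall i j : 'I_N, i != j -> 0 <= D i j)
    (Hdt : I != set0 -> dt < 1 / \big[Num.max/0]_(i in I) `|D i i|)
    (HKerA : Ker A = <[ones R N]>%VS)
    (HKerB : Ker B = <[ones R N]>%VS)
    (Hu0 : forall i : 'I_N, `|u 0%N i ord0| <= 1)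
    (Hu : is_scheme A B tau dt eps u) :
  forall (k : nat) (i : 'I_N), `|u k i ord0| <= 1.
Proof.
have A1 : A *m ones R N = 0 by apply/eqP; rewrite -mem_Ker HKerA memv_line.
have B1 : B *m ones R N = 0 by apply/eqP; rewrite -mem_Ker HKerB memv_line.
have [Munit Minv_ge0] :=
  implicit_mx_inverse_ge0 HM (mulr_ge0 (ltW dt_gt0) tau_ge0).
have M1 : (1%:M + (dt * tau) *: B) *m ones R N = ones R N.
  by rewrite mulmxDl mul1mx -scalemxAl B1 scaler0 addr0.
have P1 : (1%:M + dt *: D) *m ones R N = ones R N.
  rewrite mulmxDl mul1mx -scalemxAl mulmxBl -scalemxAl A1 B1.
  by rewrite scaler0 subr0 scaler0 addr0.
elim=> [//|k IHk] i.
have [ustar [Hlin ->]] := Hu k; rewrite mxE.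
apply: norm_nonlinear_le1; first exact: expR_gt0.
rewrite -(mulKmx Munit ustar) (linear_stepE (lt0r_neq0 dt_gt0) Hlin).
apply: norm_stochastic_mul_le1 => //; first exact: invmx_mul_fixed.
apply: norm_stochastic_mul_le1 => //.
exact: explicit_mx_ge0.
Qed.
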